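(* Let $n$ be a positive integer. If $n\equiv 2$ or $3 \pmod 4$, then the alternating group $A_n$, in its natural action on $\{1,\ldots,n\}$, does not contain a sharply $2$-transitive set of permutations.
   Context: A set $S$ of permutations of a finite set $\Omega$ is called sharply $2$-transitive on $\Omega$ if for any two pairs $(x_1,x_2)$ and $(y_1,y_2)$ of elements of $\Omega$ with $x_1\neq x_2$ and $y_1\neq y_2$ there is a unique $s\in S$ with $x_1^s=y_1$ and $x_2^s=y_2$ (where $x^s$ is the image of $x$ under $s$); $S$ need not be a subgroup. *)

(* Defs.v *)
From HB Require Import structures.
From mathcomp Require Import all_boot all_fingroup all_solvable.

Set Implicit Arguments.
Unset Strict Implicit.
Unset Printing Implicit Defensive.

(* S is an arbitrary set of permutations; it need not be a subgroup. *)
Definition sharply_2transitive (T : finType) (S : {set {perm T}}) : Prop :=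
  forall x1 x2 y1 y2 : T, x1 != x2 -> y1 != y2 ->
    exists! s : {perm T}, [/\ s \in S, s x1 = y1 & s x2 = y2].

(* Main.v *)
Require Import Defs.
From HB Require Import structures.
From mathcomp Require Import all_boot all_fingroup all_solvable.
From mathcomp Require Import all_algebra zify.

(** Consider the permutations acting on ordered pairs of distinct points of
    [{0, ..., n-1}], and compare the set [B] of increasing pairs with the set
    [C] of decreasing pairs.  A sharply 2-transitive set [S] acts sharply
    transitively on these ordered pairs, so double counting the triples
    [(s, p, q)] with [s] in [S], [p] in [B], [q] in [C] and [s p = q] gives
    [\sum_(s in S) #|{p in B | s p in C}| = #|B| * #|C|]
    ([sum_card_sharply_2transitive]).

    The summand at [s] is the number of inversions of [s], whose parity is the
    parity of [s] ([odd_inversions]); hence the left-hand side is even when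
    [S] consists of even permutations.  The right-hand side is the square of
    ['C(n, 2)], which is odd exactly when [n] is 2 or 3 modulo 4. *)

Set Implicit Arguments.
Unset Strict Implicit.
Unset Printing Implicit Defensive.

Import GRing.Theory Num.Theory.

(** Counted over the pairs [(p, q)] instead, the triples [(s, p, q)] with
    [s p = q] number one for each [p] in [B] and [q] in [C], since exactly one
    [s] in [S] maps [p] to [q]. *)
Lemma sum_card_sharply_2transitive (T : finType) (S : {set {perm T}})
    (B C : {set T * T}) :
    sharply_2transitive S ->
    (forall p, p \in B -> p.1 != p.2) -> (forall q, q \in C -> q.1 != q.2) ->
  \sum_(s in S) #|[set p in B | (s p.1, s p.2) \in C]| = #|B| * #|C|.
Proof.
move=> S2 neqB neqC.
have hit1 p q : p \in B -> q \in C ->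
    \sum_(s in S) ((s p.1, s p.2) == q : nat) = 1.
  move=> pB qC; have [s [[sS s1 s2] sU]] := S2 _ _ _ _ (neqB p pB) (neqC q qC).
  rewrite (bigD1 s) //= s1 s2 -surjective_pairing eqxx big1 ?addn0 // => t.
  case/andP=> tS nts; case: eqP => // tp; case/eqP: nts.
  by apply/esym/sU; rewrite -tp; split.
transitivity (\sum_(s in S) \sum_(p in B) \sum_(q in C)
    ((s p.1, s p.2) == q : nat)).
  apply: eq_bigr => s _; rewrite -sum1_card.
  under eq_bigl => p do rewrite inE.
  rewrite big_mkcondr; apply: eq_bigr => p _; case: ifP => spC.
    rewrite (bigD1 (s p.1, s p.2)) //= eqxx big1 // => q /andP[_].
    by rewrite eq_sym => /negbTE ->.
  by rewrite big1 // => q qC; case: eqP qC => // <-; rewrite spC.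
rewrite exchange_big -sum_nat_const; apply: eq_bigr => p pB /=.
rewrite exchange_big -[RHS]muln1 -sum_nat_const.
by apply: eq_bigr => q qC; apply: hit1.
Qed.

Definition increasing_pairs n := [set p : 'I_n * 'I_n | p.1 < p.2].
Definition decreasing_pairs n := [set p : 'I_n * 'I_n | p.2 < p.1].

Definition inversions n (s : {perm 'I_n}) :=
  [set p in increasing_pairs n | (s p.1, s p.2) \in decreasing_pairs n].

Lemma card_increasing_pairs n : #|increasing_pairs n| = 'C(n, 2).
Proof.
rewrite -sum1_card (eq_bigl (fun p : 'I_n * 'I_n => p.1 < p.2)); last first.
  by move=> p; rewrite inE.
rewrite -(pair_big_dep xpredT (fun i j : 'I_n => i < j) (fun _ _ => 1)) /=.
rewrite (exchange_big_dep predT) //= -bin2_sum big_mkord; apply: eq_bigr => j _.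
by rewrite (big_ord_narrow (ltnW (ltn_ord j))) sum1_card card_ord.
Qed.

Lemma card_decreasing_pairs n : #|decreasing_pairs n| = 'C(n, 2).
Proof.
have swapK : involutive (fun p : 'I_n * 'I_n => (p.2, p.1)) by case.
rewrite -card_increasing_pairs -(card_imset _ (inv_inj swapK)).
apply: eq_card => -[i j]; rewrite [RHS]inE /=; apply/imsetP/idP.
  by case=> -[k l]; rewrite inE /= => ltlk [-> ->].
by move=> ltij; exists (j, i); rewrite ?inE.
Qed.

(** The Vandermonde determinant of the points [0, ..., n-1] is the positive
    product of the [j - i] over [i < j].  Permuting its columns by [s]
    multiplies it by the signature of [s], and turns the product into that of
    the [s j - s i], whose sign counts the inversions. *)
Lemma odd_inversions n (s : {perm 'I_n}) : odd #|inversions s| = s.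
Proof.
pose a : 'rV[int]_n := (\row_j (j : nat)%:Z)%R.
pose b : 'rV[int]_n := (\row_j (s j : nat)%:Z)%R.
have Vb : Vandermonde n b = col_perm s (Vandermonde n a).
  by apply/matrixP=> i j; rewrite !mxE.
have sgV (u : 'rV[int]_n) : sgz (\det (Vandermonde n u))
    = (\prod_(p in increasing_pairs n) sgz (u ord0 p.2 - u ord0 p.1))%R.
  rewrite det_Vandermonde pair_big_dep /=.
  rewrite (big_morph (@sgz _) (@sgzM _) (sgz1 _)).
  by apply: eq_bigl => p; rewrite inE.
have sga : sgz (\det (Vandermonde n a)) = 1%R.
  rewrite sgV big1 // => p; rewrite inE !mxE => ltp.
  by apply: gtr0_sgz; rewrite subr_gt0 ltz_nat.
have sgb : sgz (\det (Vandermonde n b)) = ((-1) ^+ #|inversions s|)%R.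
  rewrite sgV -prodr_const.
  rewrite [RHS](eq_bigl (fun p : 'I_n * 'I_n => (p \in increasing_pairs n)
      && ((s p.1, s p.2) \in decreasing_pairs n))); last first.
    by move=> p; rewrite inE.
  rewrite big_mkcondr; apply: eq_bigr => p; rewrite !inE !mxE => ltp /=.
  case: ltngtP => [lts|lts|/val_inj/perm_inj eqp].
  - by apply: ltr0_sgz; rewrite subr_lt0 ltz_nat.
  - by apply: gtr0_sgz; rewrite subr_gt0 ltz_nat.
  - by rewrite eqp ltnn in ltp.
move: sgb; rewrite Vb col_permE det_mulmx det_perm sgzM sga mul1r odd_permV.
by rewrite -[in RHS]signr_odd; case: (odd_perm s); case: (odd _).
Qed.

Lemma odd_bin2_mod4 n :
  n = 2 %[mod 4] \/ n = 3 %[mod 4] -> odd 'C(n, 2).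
Proof.
move=> hmod; rewrite bin2.
have [q [->|->]] : exists q, n = q * 4 + 2 \/ n = q * 4 + 3.
- by exists (n %/ 4); lia.
- have -> : ((q * 4 + 2) * (q * 4 + 2).-1)./2 = (q.*2 * (q.*2 * 2 + 3)).+1 by nia.
  by rewrite /= oddM odd_double.
- have -> : ((q * 4 + 3) * (q * 4 + 3).-1)./2 = (q.*2 * (q.*2 * 2 + 5)).+3 by nia.
  by rewrite /= oddM odd_double.
Qed.

Theorem theorem5 (n : nat) (hn : 0 < n)
    (hmod : n = 2 %[mod 4] \/ n = 3 %[mod 4]) :
  ~ exists S : {set {perm 'I_n}},
      S \subset ('Alt_('I_n))%g /\ sharply_2transitive S.
Proof.
case=> S [/subsetP sSA S2].
have count : \sum_(s in S) #|inversions s| = 'C(n, 2) * 'C(n, 2).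
  rewrite -{1}card_increasing_pairs -card_decreasing_pairs.
  apply: sum_card_sharply_2transitive => // p; rewrite inE neq_ltn => ->//.
  by rewrite orbT.
have : ~~ odd (\sum_(s in S) #|inversions s|).
  elim/big_ind: _ => // [x y /negbTE ex /negbTE ey|s sS].
    by rewrite oddD ex ey.
  by rewrite odd_inversions -Alt_even; apply: sSA.
by rewrite count oddM (odd_bin2_mod4 hmod).
Qed.
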